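(* Let $a\ge 1$ and $m\ge 1$ be integers, and let $f_0$ be defined by $f_0(1)=1$, $f_0(2)=0$, and $f_0(n+2)=af_0(n)$ for $n\ge 1$. Let $c_m(n,k)$ be the function associated with $f_0$ as in the context. Then, for $1\le k\le n$, the number $c_m(n,k)$ is the number of words of length $n-1$ over the alphabet $\{0,1,\ldots,a-1,\ldots,a+m-1\}$ in which the letter $a+m-1$ appears exactly $k-1$ times, and the letters from $\{0,1,\ldots,a-1\}$ avoid runs of odd length.
   Context: For an arithmetic function $f_0$ defined on the positive integers, define recursively for $m\ge 1$ and $1\le k\le n$: $c_m(n,k)=\sum_{i_1+\cdots+i_k=n} f_{m-1}(i_1)\cdots f_{m-1}(i_k)$, the sum over positive integers $i_1,\ldots,i_k$, and $f_m(n)=\sum_{k=1}^n c_m(n,k)$. A run is a maximal block of consecutive equal letters; the run condition says that every run of a letter from $\{0,\ldots,a-1\}$ has even length. *)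

(* Defs.v *)
From mathcomp Require Import all_boot.

Set Implicit Arguments.
Unset Strict Implicit.
Unset Printing Implicit Defensive.

(* Every part of a composition of n is at most n, so bounding the parts by
   'I_n.+1 only serves to make the index type finite. *)
Definition composition_sum (f : nat -> nat) (n k : nat) : nat :=
  \sum_(i : {ffun 'I_k -> 'I_n.+1} |
         [forall j, 0 < i j] && (\sum_(j < k) i j == n))
     \prod_(j < k) f (i j).

Fixpoint f_iter (f0 : nat -> nat) (m : nat) : nat -> nat :=
  if m is m'.+1 then
    fun n => \sum_(1 <= k < n.+1) composition_sum (f_iter f0 m') n k
  else f0.

(* Meaningful for m >= 1 only. *)
Definition c (f0 : nat -> nat) (m n k : nat) : nat :=
  composition_sum (f_iter f0 m.-1) n k.

Section Runs.
Variable T : eqType.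

(* The half-open interval of positions [i, j) of s is nonempty and carries only
   the letter x. *)
Definition is_block (x : T) (s : seq T) (i j : nat) : bool :=
  (i < j <= size s) && all (pred1 x) (drop i (take j s)).

Definition is_run (x : T) (s : seq T) (i j : nat) : bool :=
  is_block x s i j &&
  [forall i' : 'I_(size s).+1, forall j' : 'I_(size s).+1,
     [&& i' <= i, j <= j' & is_block x s i' j'] ==>
     (i' == i :> nat) && (j' == j :> nat)].

End Runs.

Definition even_runs (a q : nat) (s : seq 'I_q) : bool :=
  [forall x : 'I_q, forall i : 'I_(size s).+1, forall j : 'I_(size s).+1,
     (x < a) && is_run x s i j ==> ~~ odd (j - i)].

(* Main.v *)
Require Import Defs.
From mathcomp Require Import all_boot.
From mathcomp Require Import ssralg poly zify.

Set Implicit Arguments.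
Unset Strict Implicit.
Unset Printing Implicit Defensive.

(** Both sides obey the same recurrence of order 2 in the length.

    A word satisfies the run condition exactly when it is a concatenation of
    doubled letters [xx] with [x < a] and of single letters [x >= a], because
    a run of even length is a power of a doubled letter ([even_runsE]).
    Let [W l k] be the number of such words of length [l] over [a + b.+1]
    letters in which the top letter occurs [k] times ([num_words]).  Removing
    the first factor gives
      [W l.+2 k.+1 = a * W l k.+1 + b * W l.+1 k.+1 + W l.+1 k],
    where the last term disappears if [k.+1] is replaced by 0 ([num_wordsS]).

    On the other side, [composition_sum f n k] is the coefficient of [X^n] in
    [F^k], where [F] is the generating function of [f] ([composition_sumE]).
    If [f 1 = 1], [f 2 = b] and [f n.+2 = a * f n + b * f n.+1] for [n > 0],
    that is, [F = X + b X F + a X^2 F], then multiplying by [F^k] gives the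
    recurrence of [W] for the coefficients of [F^k.+1] ([convS_rec]), whence
    [W l k = composition_sum f l.+1 k.+1] ([num_wordsE]).

    Summing that recurrence over [k] shows that the next iterate of [f]
    satisfies the same hypotheses with [b.+1] in place of [b]
    ([second_order_iter]).  The initial function satisfies them with [b = 0],
    so its iterate of rank [m.-1] satisfies them with [b = m.-1]. *)

(** * Even runs as doubled letters *)

Section EvenRuns.
Variable T : eqType.
Implicit Types (x y : T) (s : seq T).

Lemma is_blockP x s i j :
  reflect (i < j /\ forall l, i <= l < j -> onth s l = Some x)
          (is_block x s i j).
Proof.
rewrite /is_block; apply: (iffP andP) => [[/andP[ij js] /allP xs]|[ij xs]].
  split=> // l lij; rewrite onthE (nth_map x); last by lia.
  have: nth x (drop i (take j s)) (l - i) \in drop i (take j s).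
    by rewrite mem_nth // size_drop size_takel //; lia.
  by move/xs/eqP; rewrite nth_drop nth_take ?subnKC; try lia; move=> ->.
have js : j <= size s.
  have := xs j.-1 ltac:(lia); case: (leqP j (size s)) => // sj.
  by rewrite onth_default //; lia.
split; first by rewrite ij.
apply/(all_nthP x) => l; rewrite size_drop size_takel // => lij.
rewrite nth_drop nth_take; last by lia.
have /(onth_nth x) /= -> := xs (i + l) ltac:(lia).
by rewrite /= eqxx.
Qed.

Lemma is_block_size x s i j : is_block x s i j -> i < j <= size s.
Proof. by case/andP. Qed.

(** A block is maximal as soon as it cannot be extended by one position. *)
Lemma is_runP x s i j :
  reflect [/\ i < j, forall l, i <= l < j -> onth s l = Some x,
              forall l, i = l.+1 -> onth s l <> Some x
            & onth s j <> Some x]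
          (is_run x s i j).
Proof.
apply: (iffP andP) => [[blk /forallP maxij]|[ij xs xl xr]].
  have /is_blockP[ij xs] := blk; have /andP[_ js] := is_block_size blk.
  have {}maxij i' j' : i' <= i -> j <= j' -> is_block x s i' j' ->
    i' = i /\ j' = j.
    move=> ii jj blk'; have /andP[ij' js'] := is_block_size blk'.
    have i's : i' < (size s).+1 by lia.
    have /forallP/(_ (Ordinal (js' : j' < (size s).+1))) :=
      maxij (Ordinal i's).
    by rewrite /= ii jj blk' => /andP[/eqP-> /eqP->].
  split=> // [l il xl|xj].
    have [] := maxij l j; try lia.
    apply/is_blockP; split=> [|l' l'j]; first by lia.
    by have [->//|l'l] := eqVneq l' l; apply: xs; lia.
  have [] := maxij i j.+1; try lia.
  apply/is_blockP; split=> [|l' l'j]; first by lia.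
  by have [->//|l'l] := eqVneq l' j; apply: xs; lia.
split; first exact/is_blockP.
apply/forallP => i'; apply/forallP => j'; apply/implyP.
case/and3P=> ii jj /is_blockP[ij' xs'].
have -> : i' = i :> nat.
  case: (ltngtP i' i) ii => // ii _.
  by case: (xl i.-1); [lia|apply: xs'; lia].
rewrite eqxx /=; case: (ltngtP j' j) jj => // jj _.
by case: xr; apply: xs'; lia.
Qed.

End EvenRuns.

Section Doubled.
Variables a q : nat.
Implicit Types (x y : 'I_q) (s : seq 'I_q).

(** Membership in the free monoid on the words [xx] with [x < a] and the
    letters [x >= a], by reading a word from the left. *)
Fixpoint doubled s : bool :=
  match s with
  | [::] => true
  | x :: s1 =>
    if x < a then
      match s1 with
      | [::] => false
      | y :: s2 => (x == y) && doubled s2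
      end
    else doubled s1
  end.

Lemma even_runsP s :
  reflect (forall x i j, x < a -> is_run x s i j -> ~~ odd (j - i))
          (even_runs a s).
Proof.
apply: (iffP forallP) => [ev x i j xa run|ev x].
  have /andP[/is_block_size/andP[ij js] _] := run.
  have js' : j < (size s).+1 by [].
  have is' : i < (size s).+1 by lia.
  move/forallP: (ev x) => /(_ (Ordinal is'))/forallP/(_ (Ordinal js')) /=.
  by rewrite xa run.
apply/forallP => i; apply/forallP => j; apply/implyP => /andP[xa run].
exact: ev run.
Qed.

Lemma even_runs_nil : even_runs a ([::] : seq 'I_q).
Proof. by apply/even_runsP => x i j _ /andP[/is_block_size/=]; lia. Qed.

Lemma even_runs_large x s : a <= x -> even_runs a (x :: s) = even_runs a s.
Proof.
move=> ax; have neq y : y < a -> x <> y.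
  by move=> ya xy; move: ax; rewrite xy; lia.
apply/even_runsP/even_runsP => ev y i j ya /is_runP[ij ys yl yr].
  rewrite -subSS; apply: (ev y) => //; apply/is_runP; split=> //.
  - by case=> [|l] //= lij; apply: ys; lia.
  - by case=> [_ [/neq]|l [il]] //; apply: yl.
case: i j ij ys yl yr => [|i] [|j] // ij ys yl yr.
  by have [/neq] := ys 0 isT.
rewrite subSS; apply: (ev y) => //; apply/is_runP; split=> //.
- by move=> l lij; apply: (ys l.+1).
- by move=> l il; apply: (yl l.+1); rewrite il.
Qed.

(** Deleting an initial pair [xx] either shortens the first run by 2 or, when
    that run is the pair itself, deletes a run of even length; the other runs
    are translated. *)
Lemma even_runs_pair x s : even_runs a (x :: x :: s) = even_runs a s.
Proof.
apply/even_runsP/even_runsP => ev y i j ya /is_runP[ij ys yl yr].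
  (* A run of [x] at the start of [s] is the one that the pair lengthens. *)
  have [/andP[/eqP i0 /eqP yx]|shift] := boolP ((i == 0) && (y == x)).
    have: ~~ odd (j.+2 - 0).
      apply: (ev y) => //; apply/is_runP; split=> //.
      by case=> [|[|l]] //= lj; rewrite ?yx // -yx; apply: ys; lia.
    by rewrite i0 !subn0 /= negbK.
  rewrite -(subSS i j) -(subSS i.+1); apply: (ev y) => //.
  apply/is_runP; split=> //.
  - by case=> [|[|l]] //= lij; apply: ys; lia.
  - case=> [|[|l]] //= [il]; last exact: yl.
    by case=> xy; move: shift; rewrite il xy !eqxx.
case: i ij ys yl => [|[|i]] ij ys yl.
- have [xy] : Some x = Some y by apply: (ys 0); lia.
  case: j ij ys yr => [|[|[|j]]] // ij ys yr; first by case: yr; rewrite /= xy.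
  have -> : odd (j.+3 - 0) = odd (j.+1 - 0) by rewrite /= negbK.
  apply: (ev y) => //; apply/is_runP; split=> // l lj.
  by apply: (ys l.+2).
- by case: (yl 0) => //; rewrite -(ys 1) //; lia.
case: j ij ys yr => [|[|j]] // ij ys yr.
rewrite !subSS; apply: (ev y) => //; apply/is_runP; split=> //.
- by move=> l lij; apply: (ys l.+2).
- by move=> l il; apply: (yl l.+2); rewrite il.
Qed.

Lemma odd_first_run x s :
  x < a -> onth s 0 <> Some x -> even_runs a (x :: s) = false.
Proof.
move=> xa xs; apply/even_runsP => /(_ x 0 1 xa) ev.
suff /ev : is_run x (x :: s) 0 1 by [].
by apply/is_runP; split=> // -[].
Qed.

Lemma even_runsE s : even_runs a s = doubled s.
Proof.
have [n] := ubnP (size s); elim: n s => // n IHn [|x s] /= sn.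
  exact: even_runs_nil.
case: (ltnP x a) => xa; last by rewrite even_runs_large // IHn.
case: s sn => [|y s] sn; first by rewrite odd_first_run.
have [<-|xy] := eqVneq x y; first by rewrite even_runs_pair IHn //= ltnW.
by rewrite odd_first_run //= => -[yx]; rewrite yx eqxx in xy.
Qed.

End Doubled.

(** * Counting words by their first block *)

Lemma sum_tuple0 (T : finType) (F : seq T -> nat) :
  \sum_(w : 0.-tuple T) F w = F [::].
Proof.
rewrite (bigD1 [tuple]) //= big1 ?addn0 // => w /eqP[].
exact: tuple0.
Qed.

Lemma sum_tupleS (T : finType) n (F : seq T -> nat) :
  \sum_(w : n.+1.-tuple T) F w = \sum_(x : T) \sum_(t : n.-tuple T) F (x :: t).
Proof.
rewrite pair_big /=.
rewrite (reindex (fun p : T * n.-tuple T => [tuple of p.1 :: p.2])) //=.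
exists (fun w => (thead w, [tuple of behead w])) => [[x t]|w] _ /=.
  by congr pair; apply: val_inj.
by rewrite [w in RHS]tuple_eta.
Qed.

Section Words.
Variables a b : nat.

Definition top_count (s : seq 'I_(a + b.+1)) : nat :=
  count (fun x : 'I_(a + b.+1) => x == a + b.+1 - 1 :> nat) s.

Definition counted k (s : seq 'I_(a + b.+1)) : nat :=
  (top_count s == k) && doubled a s.

Definition num_words l k : nat :=
  \sum_(w : l.-tuple 'I_(a + b.+1)) counted k w.

(** A letter [x < a] at the head forces a second [x]; what follows the pair is
    again an arbitrary product of the factors. *)
Lemma num_words_doubled l k (x : 'I_(a + b.+1)) : x < a ->
  \sum_(t : l.-tuple 'I_(a + b.+1)) counted k (x :: t) =
  if l is l'.+1 then num_words l' k else 0.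
Proof.
move=> xa; have xtop : (x == a + b.+1 - 1 :> nat) = false by lia.
case: l => [|l].
  rewrite (sum_tuple0 (fun t => counted k (x :: t))).
  by rewrite /counted /= xa andbF.
rewrite (sum_tupleS _ (fun t => counted k (x :: t))).
rewrite (bigD1 x) //= [X in _ + X]big1 ?addn0 => [|y yx].
  apply: eq_bigr => t _.
  by rewrite /counted /top_count /= xtop xa eqxx.
rewrite big1 // => t _.
by rewrite /counted /= xa [x == y]eq_sym (negPf yx) andbF.
Qed.

Lemma num_words0 k : num_words 0 k = (k == 0).
Proof.
rewrite /num_words.
rewrite (sum_tuple0 (counted k)) /counted.
by rewrite andbT eq_sym.
Qed.

(** The three terms correspond to a first letter below [a], between [a] and
    the top letter, and equal to the top letter. *)
Lemma num_wordsS l k :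
  num_words l.+1 k =
    a * (if l is l'.+1 then num_words l' k else 0) + b * num_words l k
    + (if k is k'.+1 then num_words l k' else 0).
Proof.
rewrite {1}/num_words (sum_tupleS _ (counted k)).
rewrite big_split_ord big_ord_recr /= -addnA; congr (_ + (_ + _)).
- under eq_bigr => x _ do rewrite num_words_doubled ?(ltn_ord x) //.
  by rewrite sum_nat_const card_ord.
- rewrite (eq_bigr (fun=> num_words l k)) ?sum_nat_const ?card_ord // => x _.
  apply: eq_bigr => t _; rewrite /counted /top_count /=.
  have -> : (a + x == a + b.+1 - 1) = false by have := ltn_ord x; lia.
  by rewrite ltnNge leq_addr.
have top : (a + b == a + b.+1 - 1) = true by lia.
have notlow : (a + b < a) = false by lia.
case: k => [|k]; last first.
  by apply: eq_bigr => t _; rewrite /counted /top_count /= top notlow.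
by rewrite big1 // => t _; rewrite /counted /top_count /= top.
Qed.

End Words.

(** * Powers of a generating function *)

(** The coefficient of [X^n] in the [k]-th power of the generating function
    [\sum_(i > 0) f i X^i]. *)
Fixpoint conv (f : nat -> nat) (k n : nat) : nat :=
  if k is k'.+1 then \sum_(i < n) f i.+1 * conv f k' (n - i.+1) else n == 0.

Import GRing.Theory.

(** Truncating the generating function at degree [B] does not affect the
    coefficients of index at most [B] of its powers. *)
Lemma coef_truncated_exp (f : nat -> nat) B k n : n <= B ->
  (((\poly_(i < B.+1) (if i == 0%N then 0%N else f i)) ^+ k)`_n)%R = conv f k n.
Proof.
set P := (\poly_(i < B.+1) _)%R.
elim: k n => [|k IHk] n nB; first by rewrite expr0 coef1 /=; case: (n == 0).
rewrite exprS coefM big_ord_recl coef_poly /= mul0r add0r.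
apply: eq_bigr => i _ /=.
have iB : i < B by have := ltn_ord i; lia.
by rewrite coef_poly ltnS iB /= IHk //; lia.
Qed.

Lemma composition_sumE f n k : composition_sum f n k = conv f k n.
Proof.
(* Distributing the power over the sum indexes the terms by all maps from [k]
   positions to degrees; those with a part 0 have coefficient 0. *)
rewrite -(coef_truncated_exp f k (leqnn n)) poly_def.
have -> : forall p : {poly nat}, (p ^+ k = \prod_(j < k) p)%R.
  by move=> p; rewrite prodr_const card_ord.
rewrite bigA_distr_bigA /= coef_sum /composition_sum big_mkcond.
apply: eq_bigr => /= i _.
rewrite scaler_prod prodrXr coefZ coefXn eq_sym.
case: eqP => _; rewrite ?andbF ?mulr0 // andbT mulr1.
case: ifP => [/forallP ipos|/negbT/forallPn[j]].
  by apply: eq_bigr => j _; have := ipos j; case: (nat_of_ord (i j)).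
by rewrite -eqn0Ngt => ij; rewrite (bigD1 j) //= ij mul0r.
Qed.

(** Equivalently, [F = X + b X F + a X^2 F] for the generating function [F]
    above.  The value [f 0] is left free because no part of a composition is
    0; the recurrence continues one whose term of index 0 would be 0. *)
Definition second_order (a b : nat) (f : nat -> nat) : Prop :=
  [/\ f 1 = 1, f 2 = b & forall n, f n.+3 = a * f n.+1 + b * f n.+2].

(** Multiply [F = X + b X F + a X^2 F] by [F^k] and compare the coefficients
    of [X^n.+2]. *)
Lemma convS_rec a b f k n : second_order a b f ->
  conv f k.+1 n.+2 = conv f k n.+1 + b * conv f k.+1 n.+1 + a * conv f k.+1 n.
Proof.
case=> f1 f2 fS /=; rewrite 2!big_ord_recl /= f1 f2 mul1n subSS subn0.
rewrite [\sum_(i < n.+1) _]big_ord_recl /= f1 mul1n mulnDr -!addnA.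
congr (_ + _); rewrite /bump /= !subSS; congr (_ + _).
rewrite !big_distrr -big_split; apply: eq_bigr => i _ /=.
rewrite /bump /= !add1n fS !subSS; lia.
Qed.

Lemma conv_eq0 f k n : n < k -> conv f k n = 0.
Proof.
elim: k n => // k IHk n nk /=.
by rewrite big1 // => i _; rewrite IHk ?muln0 //; have := ltn_ord i; lia.
Qed.

Lemma conv1 f k : f 1 = 1 -> conv f k.+1 1 = (k == 0).
Proof.
move=> f1; rewrite /= big_ord1 f1 mul1n.
by case: k => [|k] //; rewrite conv_eq0.
Qed.

(** Let [S n] be the sum over [k] of the coefficients of [X^n] in [F^k.+1].
    Summing [convS_rec] over [k], the coefficients of [F^k] sum to [S n.+1]
    again, which is what raises [b] to [b.+1].  All sums are extended to a
    common range [k < N], the added terms being 0. *)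
Lemma second_order_iter a b f : second_order a b f ->
  second_order a b.+1
    (fun n => \sum_(1 <= k < n.+1) composition_sum f n k).
Proof.
move=> fab; have [f1 f2 _] := fab.
pose S N n := \sum_(k < N) conv f k.+1 n.
have SE N n : n <= N -> \sum_(1 <= k < n.+1) composition_sum f n k = S N n.
  move=> nN; rewrite big_add1 /= big_mkord.
  rewrite (big_ord_widen _ (fun k => composition_sum f n k.+1) nN).
  rewrite big_mkcond; apply: eq_bigr => k _; rewrite composition_sumE.
  by case: ltnP => // nk; rewrite conv_eq0.
split; first by rewrite (SE 1) // /S big_ord1 conv1.
  rewrite (SE 2) // /S 2!big_ord_recl big_ord0 !(convS_rec _ _ fab) !conv1 //.
  by rewrite !(@conv_eq0 f _ 0) //=; lia.
move=> n; rewrite (SE n.+3) // (SE n.+3 n.+1) ?(SE n.+3 n.+2); try lia.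
rewrite {1}/S.
under eq_bigr => k _ do rewrite (convS_rec _ _ fab).
rewrite !big_split /= -!big_distrr /= -/(S _ _) -/(S _ _).
suff -> : \sum_(k < n.+3) conv f k n.+2 = S n.+3 n.+2 by lia.
rewrite /S big_ord_recl [RHS]big_ord_recr [conv _ ord_max.+1 _]conv_eq0 //.
exact: addnC.
Qed.

(** Both sides satisfy the same recurrence of order 2 in [l]. *)
Lemma num_wordsE a b f l k : second_order a b f ->
  num_words a b l k = conv f k.+1 l.+1.
Proof.
move=> fab; have [f1 _ _] := fab.
elim/ltn_ind: l k => -[_|l IHl] k.
  by rewrite num_words0 conv1.
rewrite num_wordsS (convS_rec _ _ fab) IHl //.
case: l IHl => [|l] IHl; case: k => [|k]; rewrite ?IHl //.
all: rewrite -?[conv f 0 _]/0 ?(@conv_eq0 f _ 0) //; lia.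
Qed.

Theorem corollary4 (a m : nat) (ha : 1 <= a) (hm : 1 <= m)
    (f0 : nat -> nat) (f0_1 : f0 1 = 1) (f0_2 : f0 2 = 0)
    (f0_rec : forall n : nat, 1 <= n -> f0 (n + 2) = a * f0 n)
    (n k : nat) (hk : 1 <= k <= n) :
  c f0 m n k =
  #|[set w : (n - 1).-tuple 'I_(a + m) |
      (count (fun x : 'I_(a + m) => x == a + m - 1 :> nat) w == k - 1)
      && even_runs a w]|.
Proof.
have fab b : second_order a b (f_iter f0 b).
  elim: b => [|b IHb]; last exact: second_order_iter.
  by split=> // n'; rewrite /= mul0n addn0 -f0_rec // addn2.
case: m hm => // b _; case: k hk => // k; case: n => // n _.
rewrite /c /= composition_sumE -(num_wordsE n k (fab b)) !subSS !subn0.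
rewrite /num_words -sum1_card [RHS]big_mkcond /=.
apply: eq_bigr => w _; rewrite inE even_runsE /counted /top_count.
by case: ifP.
Qed.
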